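(* Fix $j\ge0$. Whenever $f\in\mathcal{L}_j^K$ we have $\underline{\sigma}_jf\doteq\overline{\sigma}_jf$. Moreover, $$\mathcal{L}_j-\mathcal{L}_j=\mathcal{L}_j^K\subseteq\mathcal{L}_{\overline{\sigma}_j}.$$
   Context: Setting. Fix $s_0\in\mathbb{R}$ and a trajectory set $\mathcal{S}$, i.e. a (nonempty) set of real sequences $S=(S_i)_{i\ge0}$ with $S_0=s_0$. For $S\in\mathcal{S}$ and $j\ge0$ let $\mathcal{S}_{(S,j)}=\{\tilde S\in\mathcal{S}:\tilde S_i=S_i,\ 0\le i\le j\}$; the pair $(S,j)$ is called a node. Put $\Delta_iS=S_{i+1}-S_i$. For every node a set $\mathcal{H}_{(S,j)}$ of portfolios is given (depending only on the node, i.e. $\mathcal H_{(\tilde S,j)}=\mathcal H_{(S,j)}$ if $\tilde S\in\mathcal S_{(S,j)}$): its elements are sequences $H=(H_i)_{i\ge j}$ of functions $H_i:\mathcal{S}_{(S,j)}\to\mathbb{R}$ that are non-anticipative, i.e. $H_i(\tilde S)=H_i(\hat S)$ whenever $\tilde S_k=\hat S_k$ for $j\le k\le i$. The following is assumed: (H.1) $\alpha\mathcal{H}_{(S,j)}+\mathcal{H}_{(S,j)}\subseteq\mathcal{H}_{(S,j)}$ for all $\alpha\ge0$; (H.2) every $(H_i)_{i\ge j}$ with each $H_i$ constant on $\mathcal{S}_{(S,j)}$ with value $-1$, $0$ or $1$ belongs to $\mathcal{H}_{(S,j)}$; (H.3) if $(H_i)_{i\ge j}\in\mathcal{H}_{(S,j)}$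 and $k\ge j$ then $(H_i|_{\mathcal{S}_{(S,k)}})_{i\ge k}\in\mathcal{H}_{(S,k)}$; (H.4) if $(H_i)_{i\ge j}\in\mathcal{H}_{(S,j)}$, $k\ge j$, $G_i=H_i$ for $j\le i\le k$ and $G_i=0$ for $i>k$, then $G\in\mathcal{H}_{(S,j)}$. Elementary functions. For $V\in\mathbb{R}$, $H\in\mathcal{H}_{(S,j)}$, $n\ge j$ let $\Pi^{V,H}_{j,n}(\tilde S)=V+\sum_{i=j}^{n-1}H_i(\tilde S)\Delta_i\tilde S$ for $\tilde S\in\mathcal{S}_{(S,j)}$; $\mathcal{D}_{(S,j)}$ is the set of all such functions, $\mathcal{D}_{(S,j)}^+$ its non-negative elements, $\mathcal{D}_{(S,j)}^-=-\mathcal{D}_{(S,j)}^+$, $\mathcal{E}_{(S,j)}=\mathcal{D}_{(S,j)}^+-\mathcal{D}_{(S,j)}^+$. $\mathcal{D}_j$ is the set of $f:\mathcal{S}\to\mathbb{R}$ with $f|_{\mathcal{S}_{(S,j)}}\in\mathcal{D}_{(S,j)}$ for all $S\in\mathcal{S}$; $\mathcal{D}_j^+$ its non-negative elements, $\mathcal{E}_j=\mathcal{D}_j^+-\mathcal{D}_j^+$. Functions in $\mathcal{D}_{(S,j)},\mathcal{E}_{(S,j)}$ are regarded as functions on $\mathcal{S}$ by extending them by $0$. Standing assumption 1 (local $0$-neutrality): $\sup_{\tilde S\in\mathcal{S}_{(S,j)}}(\tilde S_{j+1}-S_j)\ge0\ge\inf_{\tilde S\in\mathcal{S}_{(S,j)}}(\tilde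 S_{j+1}-S_j)$ at every node. Then $I_jf(S)=V$ for $f\in\mathcal{D}_j^+$ with $f|_{\mathcal{S}_{(S,j)}}=\Pi^{V,H}_{j,n}$ is well defined, and $I_j$ extends linearly to $\mathcal{E}_j$. Norm and a.e. $Q$ is the set of functions $\mathcal{S}\to[-\infty,\infty]$, $P\subseteq Q$ the non-negative ones. Conventions: $0\cdot\infty=0$, $\infty+(-\infty)=\infty$, $u-v=u+(-v)$, $\inf\emptyset=\infty$. For $f\in P$, $\overline{I}_jf(S)=\inf\{\sum_{m\ge1}V^m: f\le\sum_{m\ge1}f_m\text{ on }\mathcal{S}_{(S,j)},\ f_m=\Pi^{V^m,H^m}_{j,n_m}\in\mathcal{D}_{(S,j)}^+\}$; for $f\in Q$, $\|f\|_j(S)=\overline{I}_j|f|(S)$ and $\|f\|=\|f\|_0$ (a constant). $E\subseteq\mathcal{S}$ is null if $\|\mathbf{1}_E\|=0$; ''a.e.'' means off a null set, and $\doteq$ denotes equality a.e. A property holds a.e. on $\mathcal{S}_{(S,j)}$ if the set $E$ of points of $\mathcal{S}_{(S,j)}$ where it fails satisfies $\|\mathbf{1}_E\|_j(S)=0$. Conditional integral. For $f\in Q$, $\overline{\sigma}_jf(S)=\inf\{\sum_{m\ge0}V^m: f\le\sum_{m\ge0}f_m\text{ on }\mathcal{S}_{(S,j)},\ f_0=\Pi^{V^0,H^0}_{j,n_0}\in\mathcal{D}_{(S,j)}^-,\ f_m=\Pi^{V^m,H^m}_{j,n_m}\in\mathcal{D}_{(S,j)}^+\ (m\ge1)\}$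 (for $f_0\in\mathcal D_{(S,j)}^-=-\mathcal D_{(S,j)}^+$, $H^0$ is the negative of a portfolio and $V^0=-I_j(-f_0)(S)$), and $\underline{\sigma}_jf=-\overline{\sigma}_j(-f)$. Standing assumption 2: $\overline{\sigma}_j0=0$ on $\mathcal{S}$ for all $j\ge0$. $\mathcal{L}_{\overline{\sigma}_j}=\{f\in Q:\overline{\sigma}_jf-\underline{\sigma}_jf=0\text{ a.e.}\}$. Classes. $\mathcal{M}_j(S)$ is the set of $v=\sum_{m\ge1}f_m$ with $f_m\in\mathcal{D}_j^+$ and $\sum_mI_jf_m(S)<\infty$. $\mathcal{L}_j$: all $f:\mathcal{S}\to[0,\infty]$ such that for a.e. $S$: for all $\epsilon>0$ there are $u,v\in\mathcal{M}_j(S)$ with $f=v-u$ a.e. on $\mathcal{S}_{(S,j)}$ and $\overline{I}_ju(S)\le\epsilon$. $\mathcal{L}_j-\mathcal{L}_j=\{f_1-f_2:f_1,f_2\in\mathcal{L}_j\}$. $\mathcal{L}_j^K$: all $f\in Q$ such that for a.e. $S$: for all $\epsilon>0$ there are $u,v\in\mathcal{M}_j(S)$, $h\in\mathcal{E}_{(S,j)}$ with $f=h+v-u$ a.e. on $\mathcal{S}_{(S,j)}$ and $\overline{I}_ju(S)\le\epsilon$, $\overline{I}_jv(S)\le\epsilon$. *)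

(* Defs.v *)
(* MathComp-Analysis. *)
From mathcomp Require Import all_boot all_order all_algebra.
From mathcomp Require Import all_classical all_reals all_analysis.

Set Implicit Arguments.
Unset Strict Implicit.
Unset Printing Implicit Defensive.

Import Order.TTheory GRing.Theory Num.Theory.

Local Open Scope classical_set_scope.
Local Open Scope ring_scope.

(* A trajectory set is X : set (nat -> R); functions on it have the type [X]
   as domain, and [val S i] is the i-th coordinate of the trajectory S : X. *)

Definition node (R : realType) (X : set (nat -> R)) (S : X) (j : nat) : set X :=
  [set T | forall i, (i <= j)%N -> val T i = val S i].

(* A family of functions H_i : node S j -> R (i >= j) is represented by any
   total H : nat -> X -> R that agrees with it there.  The axiom [pf_ext] says
   that membership depends only on the represented family; the restriction of
   a portfolio to a later node is then represented by the same H. *)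
Record portfolio_system (R : realType) (X : set (nat -> R))
    (port : X -> nat -> set (nat -> X -> R)) : Prop := PortfolioSystem {
  pf_ext : forall S j H G, port S j H ->
    (forall i T, (j <= i)%N -> node S j T -> G i T = H i T) -> port S j G;
  pf_node : forall S T j, node S j T -> port T j = port S j;
  pf_nonanticipative : forall S j H, port S j H ->
    forall i T U, (j <= i)%N -> node S j T -> node S j U ->
    (forall k, (j <= k <= i)%N -> val T k = val U k) -> H i T = H i U;
  pf_cone : forall S j (a : R) H G, 0 <= a -> port S j H -> port S j G ->
    port S j (fun i T => a * H i T + G i T);
  pf_const : forall S j (c : nat -> R),
    (forall i, [\/ c i = -1, c i = 0 | c i = 1]) ->
    port S j (fun i _ => c i);
  pf_restrict : forall S j k H, (j <= k)%N -> port S j H -> port S k H;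
  pf_stop : forall S j k H, (j <= k)%N -> port S j H ->
    port S j (fun i T => if (i <= k)%N then H i T else 0)
}.

Definition local_0_neutral (R : realType) (X : set (nat -> R)) : Prop :=
  forall (S : X) (j : nat),
    (0 <= ereal_sup [set (val T j.+1 - val S j)%:E | T in node S j])%E /\
    (ereal_inf [set (val T j.+1 - val S j)%:E | T in node S j] <= 0)%E.

Section Integrals.
Context (R : realType) (X : set (nat -> R)).
Variable port : X -> nat -> set (nat -> X -> R).
Implicit Types (S T : X) (j n : nat) (f u v : X -> \bar R) (g h : X -> R).

Definition Pi (V : R) (H : nat -> X -> R) j n T : R :=
  V + \sum_(j <= i < n) H i T * (val T i.+1 - val T i).

Definition restr0 S j g : X -> R := patch (fun=> 0) (node S j) g.

(* [represents S j g V]: g is Pi^{V,H}_{j,n} on the node, for some H in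
   H_(S,j) and n >= j, and vanishes off the node. *)
Definition represents S j g (V : R) : Prop :=
  exists H n, [/\ port S j H, (j <= n)%N & g = restr0 S j (Pi V H j n)].

Definition Dnode S j : set (X -> R) := [set g | exists V, represents S j g V].

Definition Dnode_pos S j : set (X -> R) :=
  [set g | Dnode S j g /\ forall T, 0 <= g T].

Definition Enode S j : set (X -> R) :=
  [set (fun T => g T - h T) | g in Dnode_pos S j & h in Dnode_pos S j].

Definition Dglob j : set (X -> R) :=
  [set g | forall S, Dnode S j (restr0 S j g)].

Definition Dglob_pos j : set (X -> R) :=
  [set g | Dglob j g /\ forall T, 0 <= g T].

(* I_j on D_j^+: the value V is unique under local 0-neutrality. *)
Definition I j g S : R := xget 0 [set V | represents S j (restr0 S j g) V].

Definition Ibar j f S : \bar R :=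
  ereal_inf [set c | exists (g : nat -> X -> R) (V : nat -> R),
    [/\ forall m, Dnode_pos S j (g m) /\ represents S j (g m) (V m),
        forall T, node S j T -> (f T <= \sum_(0 <= m <oo) (g m T)%:E)%E
      & c = (\sum_(0 <= m <oo) (V m)%:E)%E]].

Definition norm_cond j f S : \bar R := Ibar j (fun T => `|f T|%E) S.

(* The norm ||.|| is norm_cond 0, which is constant in S. *)
Definition null (E : set X) : Prop :=
  forall S, norm_cond 0 (fun T => (\1_E T)%:E) S = 0%E.

Definition ae (P : X -> Prop) : Prop := null [set T | ~ P T].

Definition ae_node S j (P : X -> Prop) : Prop :=
  norm_cond j (fun T => (\1_[set U | node S j U /\ ~ P U] T)%:E) S = 0%E.

(* The element of D_(S,j)^- is f_0 = - g0, with g0 in D_(S,j)^+ of value V0. *)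
Definition sigma_up j f S : \bar R :=
  ereal_inf [set c | exists (g0 : X -> R) (V0 : R)
                            (g : nat -> X -> R) (V : nat -> R),
    [/\ Dnode_pos S j g0 /\ represents S j g0 V0,
        forall m, Dnode_pos S j (g m) /\ represents S j (g m) (V m),
        forall T, node S j T ->
          (f T <= (- g0 T)%:E + \sum_(0 <= m <oo) (g m T)%:E)%E
      & c = ((- V0)%:E + \sum_(0 <= m <oo) (V m)%:E)%E]].

Definition sigma_low j f S : \bar R := (- sigma_up j (fun T => - f T) S)%E.

(* The scope %dE is used wherever +oo and -oo may be added: there
   +oo + -oo = +oo, whereas the default addition gives -oo. *)
Definition Lsigma j : set (X -> \bar R) :=
  [set f | ae (fun S => (sigma_up j f S - sigma_low j f S)%dE = 0%E)].

Definition Mclass j S : set (X -> \bar R) :=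
  [set v | exists g : nat -> X -> R,
    [/\ forall m, Dglob_pos j (g m),
        (\sum_(0 <= m <oo) (I j (g m) S)%:E < +oo)%E
      & v = (fun T => \sum_(0 <= m <oo) (g m T)%:E)%E]].

Definition Lclass j : set (X -> \bar R) :=
  [set f | (forall T, (0 <= f T)%E) /\
    ae (fun S => forall eps : R, 0 < eps -> exists u v,
      [/\ Mclass j S u, Mclass j S v,
          ae_node S j (fun T => f T = (v T - u T)%dE)
        & (Ibar j u S <= eps%:E)%E])].

Definition Ldiff j : set (X -> \bar R) :=
  [set (fun T => (f1 T - f2 T)%dE : \bar R) | f1 in Lclass j & f2 in Lclass j].

Definition LKclass j : set (X -> \bar R) :=
  [set f | ae (fun S => forall eps : R, 0 < eps -> exists u v h,
    [/\ Mclass j S u /\ Mclass j S v, Enode S j h,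
        ae_node S j (fun T => f T = ((h T)%:E + v T - u T)%dE),
        (Ibar j u S <= eps%:E)%E
      & (Ibar j v S <= eps%:E)%E])].

End Integrals.

(* Main.v *)
Require Import Defs.
From mathcomp Require Import all_boot all_order all_algebra.
From mathcomp Require Import all_classical all_reals all_analysis.
From mathcomp Require Import lra.

(** The norm and the conditional integral are infima of prices of countable
    superhedges. The assumption that the conditional integral vanishes at zero
    says that no hedge of zero has a negative price. It makes the value of a
    non-negative payoff unique and non-negative ([pos_represents_mono]), and,
    applied to the sum of a hedge of f and a hedge of -f, it gives
    sigma_low f <= sigma_up f at every node ([sigma_low_le_up]).

    For the converse inequality let f = h1 - h2 + v - u almost everywhere on a
    node, with payoffs h1, h2 of values V1, V2 and series u, v of small norm.
    Then h1 - h2 + v hedges f and h2 - h1 + u hedges -f, except on a negligible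
    set. The norm is countably subadditive ([Ibar_series]), so that infinitely
    many copies of the indicator of a negligible set still have norm zero: the
    exceptional set is hedged at no cost, whatever the values of f on it
    ([sigma_up_le_ae]). Hence both integrals are within any eps of V1 - V2;
    they are equal and finite ([sigma_eq]).

    The classes agree for two reasons. A series in Mclass is a payoff plus a
    tail of small norm ([Mclass_split]), which turns a difference of functions
    v1 - u1 and v2 - u2 of Lclass into h1 - h2 plus small series
    ([Ldiff_LKclass_at]). Conversely, h1 - h2 + v - u is the difference of the
    series h1 + v and h2 + u; choosing them once per node and gluing gives two
    functions of Lclass whose difference is f ([LKclass_sub_Ldiff]). *)

Set Implicit Arguments.
Unset Strict Implicit.
Unset Printing Implicit Defensive.

Import Order.TTheory GRing.Theory Num.Theory.

Local Open Scope classical_set_scope.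
Local Open Scope ring_scope.

(** * Extended-real arithmetic and series *)

Section ExtendedReals.
Context (R : realType).

Local Open Scope ereal_scope.

(** The difference is +oo only where v is, and -oo only where u is; so each of
    the two bounds may drop one of the series. *)
Lemma dsub_le (a : R) (v u x : \bar R) : 0 <= v -> 0 <= u ->
  x = (a%:E + v - u)%dE -> x <= a%:E + v /\ - x <= (- a)%:E + u.
Proof.
move=> v0 u0 ->; move: v0 u0.
case: v => [v| |] //; case: u => [u| |] //; rewrite ?lee_fin /= => v0 u0.
all: by split; rewrite ?leey ?leNye //; lra.
Qed.

Lemma dsub_split (a b : R) (v u : \bar R) : 0 <= v -> 0 <= u ->
  ((a - b)%R%:E + v - u)%dE = ((a%:E + v)%E - (b%:E + u)%E)%dE.
Proof.
case: v => [v| |] //; case: u => [u| |] //= v0 u0.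
by congr EFin; lra.
Qed.

(** Finiteness is needed: with v2 = u2 = +oo and the other terms finite, the
    left-hand side is -oo and the right-hand side +oo. *)
Lemma dsub_merge (a b : R) (v1 u1 v2 u2 : \bar R) :
  0 <= v1 -> 0 <= u1 -> 0 <= v2 -> 0 <= u2 ->
  v1 < +oo -> u1 < +oo -> v2 < +oo -> u2 < +oo ->
  (((a%:E + v1)%E - u1) - ((b%:E + v2)%E - u2))%dE =
  ((a - b)%R%:E + (v1 + u2)%E - (u1 + v2)%E)%dE.
Proof.
case: v1 => [v1| |] //; case: u1 => [u1| |] //.
case: v2 => [v2| |] //; case: u2 => [u2| |] // *.
by congr EFin; lra.
Qed.

(** Where the decompositions below are not available, a function is split by its
    sign; the dual subtraction reproduces infinite values as well. *)
Lemma dsub_pos_neg (x : \bar R) : (maxe x 0 - maxe (- x) 0)%dE = x.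
Proof.
case: x => [r| |].
- have [r0|r0] := leP 0%R r.
    have -> : maxe r%:E 0 = r%:E by apply: max_l; rewrite lee_fin.
    have -> : maxe (- r%:E) 0 = 0 by apply: max_r; rewrite leeNl oppe0 lee_fin.
    by rewrite /= oppr0 addr0.
  have -> : maxe r%:E 0 = 0 by apply: max_r; rewrite lee_fin ltW.
  have -> : maxe (- r%:E) 0 = (- r)%:E by apply: max_l; rewrite lee_fin oppr_ge0 ltW.
  by rewrite /= opprK add0r.
- have -> : maxe +oo 0 = +oo :> \bar R by apply: max_l; exact: leey.
  by [].
- have -> : maxe -oo 0 = 0 :> \bar R by apply: max_r; exact: leNye.
  by have -> : maxe (- -oo) 0 = +oo :> \bar R by apply: max_l; exact: leey.
Qed.

Definition cons_seq (A : Type) (a : A) (s : nat -> A) n :=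
  if n is m.+1 then s m else a.

Lemma nneseries_cons (a : R) (s : nat -> R) :
  (0 <= a)%R -> (forall n, 0 <= s n)%R ->
  \sum_(0 <= n <oo) (cons_seq a s n)%:E = a%:E + \sum_(0 <= n <oo) (s n)%:E.
Proof.
move=> a0 s0; rewrite nneseries_recl => [|[|n] _|//] /=; rewrite ?lee_fin //.
congr (_ + _); rewrite -nneseries_addn => [|[|n]]; rewrite ?lee_fin //=.
by apply: eq_eseriesr => i _; rewrite addn1.
Qed.

Lemma eseries_single (a : R) :
  \sum_(0 <= n <oo) (cons_seq a (fun=> 0%R) n)%:E = a%:E.
Proof.
apply: lim_near_cst => //; exists 1%N => //= -[|n] // _.
by rewrite /= big_nat_recl //= big1 ?adde0.
Qed.

(** The enumeration does not depend on the family, so that the same reordering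
    applies to the functions of a cover and to their values. *)
Lemma nneseries_pairs : exists e : nat -> nat * nat,
  forall a : nat -> nat -> \bar R, (forall k m, 0 <= a k m) ->
  \sum_(0 <= n <oo) a (e n).1 (e n).2 =
  \sum_(0 <= k <oo) \sum_(0 <= m <oo) a k m.
Proof.
have /card_set_bijP[e eb] : ([set: nat] #= [set: nat * nat])%card.
  by rewrite card_eq_sym; exact: card_nat2.
exists e => a a0; rewrite nneseries_esumT => [|n]; last exact: a0.
rewrite nneseries_esumT => [|n]; last by apply: nneseries_ge0 => *; exact: a0.
rewrite [RHS](eq_esum (b := fun k => \esum_(m in [set: nat]) a k m)) => [|k _]; last first.
  by rewrite nneseries_esumT // => m; exact: a0.
rewrite esum_esum // (_ : _ `*`` _ = [set: nat * nat]); last by apply/seteqP; split.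
by rewrite (reindex_esum _ _ _ _ eb).
Qed.

End ExtendedReals.

Section ConditionalIntegral.
Context (R : realType) (X : set (nat -> R)).
Context (port : X -> nat -> set (nat -> X -> R)).
Context (port_ax : portfolio_system port).
Implicit Types (S T U : X) (j n : nat) (f u v w : X -> \bar R) (g h : X -> R).

(** * Nodes and payoffs *)

Lemma node_eq S T j : node S j T -> node T j = node S j.
Proof.
move=> ST; apply/seteqP; split => U UT i ij; first by rewrite UT // ST.
by rewrite UT // ST.
Qed.

Lemma restr0_in S j g T : node S j T -> restr0 S j g T = g T.
Proof. by move=> ST; rewrite /restr0 /patch mem_set. Qed.

Lemma restr0_out S j g T : ~ node S j T -> restr0 S j g T = 0.
Proof. by move=> ST; rewrite /restr0 /patch memNset. Qed.

Lemma restr0_ge0 S j g : (forall T, 0 <= g T) -> forall T, 0 <= restr0 S j g T.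
Proof. by move=> g0 T; rewrite /restr0 /patch; case: ifP. Qed.

Lemma restr0D S j g h :
  restr0 S j (fun T => g T + h T) = (fun T => restr0 S j g T + restr0 S j h T).
Proof. by apply/funext => T; rewrite /restr0 /patch; case: ifP; rewrite ?addr0. Qed.

Lemma restr0_id S j g : restr0 S j (restr0 S j g) = restr0 S j g.
Proof. by apply/funext => T; rewrite /restr0 /patch; case: ifP => // ->. Qed.

Lemma represents_off_node S j g V T : represents port S j g V -> ~ node S j T -> g T = 0.
Proof. move=> [H [n [_ _ ->]]] nST. exact: restr0_out. Qed.

Lemma restr0_represents S j g V : represents port S j g V -> restr0 S j g = g.
Proof. by case=> H [n [_ _ ->]]; rewrite restr0_id. Qed.

(** Trading can be stopped at the horizon, so a payoff is also represented at
    every later horizon. This is what allows two payoffs to be added: they are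
    first brought to a common horizon. *)
Lemma represents_stopped S j g V : represents port S j g V ->
  exists H n, [/\ port S j H, (j <= n)%N &
    forall m, (n <= m)%N -> g = restr0 S j (Pi V H j m)].
Proof.
case=> H [n [pH jn ->]].
have [->|nj] := eqVneq n j.
  exists (fun _ _ => 0), j; split => // [|m jm].
    by apply: (@pf_const _ _ _ port_ax S j (fun=> 0)) => i; exact: Or32.
  congr restr0; apply/funext => T; rewrite /Pi big_geq // big1 // => i _.
  by rewrite mul0r.
have {nj} jn' : (j < n)%N by rewrite ltn_neqAle eq_sym nj.
exists (fun i T => if (i <= n.-1)%N then H i T else 0), n; split => // [|m nm].
  by apply: (pf_stop port_ax) => //; rewrite -ltnS prednK // (leq_trans _ jn').
congr restr0; apply/funext => T; rewrite /Pi [in RHS](big_cat_nat jn nm) /=.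
rewrite [X in _ = _ + (_ + X)]big1_seq ?addr0.
  congr (_ + _); apply: eq_big_nat => i /andP[_ i_n].
  by rewrite -ltnS prednK ?i_n // (leq_ltn_trans _ i_n).
move=> i; rewrite mem_index_iota => /andP[_ /andP[ni _]].
by rewrite leqNgt -subn1 ltn_subLR ?add1n ?ltnS ?ni ?mul0r // (leq_ltn_trans _ jn').
Qed.

Lemma representsD S j g h V W : represents port S j g V ->
  represents port S j h W -> represents port S j (fun T => g T + h T) (V + W).
Proof.
move=> /represents_stopped[H [n [pH jn gE]]] /represents_stopped[G [m [pG jm hE]]].
exists (fun i T => 1 * H i T + G i T), (maxn n m); split.
- exact: (pf_cone port_ax).
- by rewrite (leq_trans jn) // leq_maxl.
rewrite (gE (maxn n m)) ?leq_maxl// (hE (maxn n m)) ?leq_maxr//.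
rewrite -restr0D; congr restr0; apply/funext => T.
rewrite /Pi addrACA -big_split /=; congr (_ + _); apply: eq_bigr => i _.
by rewrite mul1r mulrDl.
Qed.

Lemma represents0 S j : represents port S j (fun=> 0) 0.
Proof.
exists (fun _ _ => 0), j; split => //.
  by apply: (@pf_const _ _ _ port_ax S j (fun=> 0)) => i; exact: Or32.
apply/funext => T; rewrite /restr0 /patch; case: ifP => // _.
by rewrite /Pi big_geq // addr0.
Qed.

Lemma represents_node S T j : node S j T -> represents port T j = represents port S j.
Proof.
by move=> ST; rewrite /represents (pf_node port_ax ST) /restr0 (node_eq ST).
Qed.

(** A payoff at one node, extended by zero, is a payoff at all nodes at time j:
    the other nodes are disjoint from the first one. *)
Lemma Dglob_pos_restr0 S j g : Dnode_pos port S j g -> Dglob_pos port j g.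
Proof.
case=> -[V gV] g0; split => // T.
have [ST|nST] := pselect (node S j T).
  exists V; rewrite (represents_node ST).
  rewrite (_ : restr0 T j g = g) // /restr0 (node_eq ST).
  exact: restr0_represents gV.
exists 0; rewrite (_ : restr0 T j g = fun=> 0); first exact: represents0.
apply/funext => U; rewrite /restr0 /patch; case: ifPn => // /set_mem TU.
apply: (represents_off_node gV) => SU; apply: nST => i ij.
by rewrite -(TU _ ij) (SU _ ij).
Qed.

(** The form in which payoffs enter the definitions of Ibar and sigma_up, to
    which it unfolds. *)
Definition pos_represents S j g V := Dnode_pos port S j g /\ represents port S j g V.

Lemma pos_representsI S j g V :
  (forall T, 0 <= g T) -> represents port S j g V -> pos_represents S j g V.
Proof. by move=> g0 gV; split => //; split => //; exists V. Qed.

Lemma pos_represents_ge0 S j g V : pos_represents S j g V -> forall T, 0 <= g T.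
Proof. by case=> -[]. Qed.

Lemma pos_represents_ex S j g : Dnode_pos port S j g -> exists V, pos_represents S j g V.
Proof. by case=> -[V gV] g0; exists V; exact: pos_representsI. Qed.

Lemma pos_represents0 S j : pos_represents S j (fun=> 0) 0.
Proof. exact: pos_representsI (represents0 _ _). Qed.

Lemma pos_representsD S j g h V W : pos_represents S j g V -> pos_represents S j h W ->
  pos_represents S j (fun T => g T + h T) (V + W).
Proof.
move=> gV hW; apply: pos_representsI => [T|].
  by rewrite addr_ge0 ?(pos_represents_ge0 gV) ?(pos_represents_ge0 hW).
exact: representsD gV.2 hW.2.
Qed.

(** * Values of payoffs *)

Context (sigma0 : forall j S, sigma_up port j (fun=> 0%E) S = 0%E).

Local Open Scope ereal_scope.

(** The assumption that sigma_up vanishes at zero, read as a no-arbitrage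
    principle: a hedge of zero has non-negative price. *)
Lemma sigma_up_ge0 S j g0 V0 (g : nat -> X -> R) (V : nat -> R) :
  pos_represents S j g0 V0 -> (forall m, pos_represents S j (g m) (V m)) ->
  (forall T, node S j T -> 0 <= (- g0 T)%:E + \sum_(0 <= m <oo) (g m T)%:E) ->
  0 <= (- V0)%:E + \sum_(0 <= m <oo) (V m)%:E.
Proof.
move=> h0 h h1; rewrite -[leLHS](sigma0 j S); apply: ereal_inf_lbound.
by exists g0, V0, g, V; split.
Qed.

(** Selling g and buying h is a hedge of zero. With g = 0 this gives
    non-negativity of values, and with g = h their uniqueness. *)
Lemma pos_represents_mono S j g h V W : pos_represents S j g V -> pos_represents S j h W ->
  (forall T, g T <= h T)%R -> (V <= W)%R.
Proof.
move=> gV hW gh.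
rewrite -subr_ge0 addrC -lee_fin EFinD -[W%:E]eseries_single.
apply: (sigma_up_ge0 (S := S) (j := j) (g := cons_seq h (fun _ _ => 0%R)) gV).
  by case=> [|m] //=; exact: pos_represents0.
move=> T _; rewrite (eq_eseriesr (g := fun n => (cons_seq (h T) (fun=> 0%R) n)%:E)).
  by rewrite eseries_single -EFinD lee_fin addrC subr_ge0.
by case.
Qed.

Lemma pos_represents_val_ge0 S j g V : pos_represents S j g V -> (0 <= V)%R.
Proof.
by move=> gV; exact: pos_represents_mono (pos_represents0 S j) gV (pos_represents_ge0 gV).
Qed.

Lemma pos_represents_uniq S j g V W : pos_represents S j g V -> pos_represents S j g W ->
  V = W.
Proof.
move=> gV gW; apply/eqP; rewrite eq_le.
by rewrite (pos_represents_mono gV gW) ?(pos_represents_mono gW gV).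
Qed.

Lemma I_pos_represents S j g V : pos_represents S j (restr0 S j g) V -> I port j g S = V.
Proof.
move=> gV; apply: (@pos_represents_uniq S j (restr0 S j g)) => //.
split; first by case: gV.
by apply: xgetPex; exists V; case: gV.
Qed.

Lemma pos_represents_I S j g : Dglob_pos port j g ->
  pos_represents S j (restr0 S j g) (I port j g S).
Proof.
case=> gD g0.
have [|V gV] := @pos_represents_ex S j (restr0 S j g).
  by split; [exact: gD|exact: restr0_ge0].
by rewrite (I_pos_represents gV).
Qed.

Lemma I_ge0 S j g : Dglob_pos port j g -> (0 <= I port j g S)%R.
Proof. by move=> gD; exact: pos_represents_val_ge0 (pos_represents_I S gD). Qed.

Lemma Dglob_posD j g h : Dglob_pos port j g -> Dglob_pos port j h ->
  Dglob_pos port j (fun T => g T + h T)%R.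
Proof.
move=> gD hD; split=> [S|T]; last by rewrite addr_ge0 ?gD.2 ?hD.2.
have [[]] := pos_representsD (pos_represents_I S gD) (pos_represents_I S hD).
by rewrite restr0D.
Qed.

Lemma I_D S j g h : Dglob_pos port j g -> Dglob_pos port j h ->
  I port j (fun T => g T + h T)%R S = (I port j g S + I port j h S)%R.
Proof.
move=> gD hD; apply: I_pos_represents; rewrite restr0D.
exact: pos_representsD (pos_represents_I S gD) (pos_represents_I S hD).
Qed.

Lemma Dglob_pos0 j : Dglob_pos port j (fun=> 0%R).
Proof.
split => // S; exists 0%R; rewrite (_ : restr0 _ _ _ = fun=> 0%R); first exact: represents0.
by apply/funext => T; rewrite /restr0 /patch; case: ifP.
Qed.

Lemma I0 S j : I port j (fun=> 0%R) S = 0%R.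
Proof.
apply: I_pos_represents; rewrite (_ : restr0 _ _ _ = fun=> 0%R); first exact: pos_represents0.
by apply/funext => T; rewrite /restr0 /patch; case: ifP.
Qed.

Lemma Dglob_pos_sum j (g : nat -> X -> R) n : (forall m, Dglob_pos port j (g m)) ->
  Dglob_pos port j (fun T => \sum_(0 <= m < n) g m T)%R.
Proof.
move=> gD; elim: n => [|n IH].
  rewrite (_ : (fun _ => _) = fun=> 0%R); first exact: Dglob_pos0.
  by apply/funext => T; rewrite big_geq.
rewrite (_ : (fun _ => _) = fun T => \sum_(0 <= m < n) g m T + g n T)%R.
  exact: Dglob_posD.
by apply/funext => T; rewrite big_nat_recr.
Qed.

(** * Superhedging norm *)

(** Ibar is by conversion the infimum of these costs; as objects of their own,
    covers can be added and concatenated. *)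
Definition cover S j f (c : \bar R) := exists (g : nat -> X -> R) (V : nat -> R),
    [/\ forall m, pos_represents S j (g m) (V m),
        forall T, node S j T -> f T <= \sum_(0 <= m <oo) (g m T)%:E
      & c = \sum_(0 <= m <oo) (V m)%:E].

Lemma IbarE S j f : Ibar port j f S = ereal_inf [set c | cover S j f c].
Proof. by []. Qed.

Lemma cover_ge0 S j f c : cover S j f c -> 0 <= c.
Proof.
case=> g [V [gV _ ->]]; apply: nneseries_ge0 => n _ _.
by rewrite lee_fin (pos_represents_val_ge0 (gV n)).
Qed.

Lemma Ibar_ge0 S j f : 0 <= Ibar port j f S.
Proof. by apply: le_ereal_inf_tmp => c /cover_ge0. Qed.

Lemma Ibar_le S j f f' : (forall T, node S j T -> f T <= f' T) ->
  Ibar port j f S <= Ibar port j f' S.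
Proof.
move=> ff'; apply: ereal_inf_le_tmp => c [g [V [gV f'g ->]]].
by exists g, V; split => // T ST; exact: le_trans (ff' _ ST) (f'g _ ST).
Qed.

Lemma Ibar_lt S j f c : Ibar port j f S < c -> exists2 d, cover S j f d & d < c.
Proof. by move=> /ereal_inf_lt. Qed.

Lemma cover_Ibar S j f c : cover S j f c -> Ibar port j f S <= c.
Proof. by move=> fc; exact: ereal_inf_lbound. Qed.

Lemma cover_series S j (f : nat -> X -> \bar R) (c : nat -> \bar R) :
  (forall k T, 0 <= f k T) -> (forall k, cover S j (f k) (c k)) ->
  cover S j (fun T => \sum_(0 <= k <oo) f k T) (\sum_(0 <= k <oo) c k).
Proof.
move=> f0 fc; have [e eE] := nneseries_pairs R.
have /choice[g /choice[V gV]] := fc.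
exists (fun n => g (e n).1 (e n).2), (fun n => V (e n).1 (e n).2).
split=> [n|T ST|].
- by have [] := gV (e n).1.
- rewrite (eE (fun k m => (g k m T)%:E)).
    by apply: lee_nneseries => // k _; have [_ + _] := gV k; exact.
  by move=> k m; have [+ _ _] := gV k; move=> /(_ m)/pos_represents_ge0; rewrite lee_fin.
- rewrite (eE (fun k m => (V k m)%:E)).
    by apply: eq_eseriesr => k _; have [] := gV k.
  by move=> k m; have [+ _ _] := gV k; move=> /(_ m)/pos_represents_val_ge0; rewrite lee_fin.
Qed.

(** The errors eps / 2 ^ k.+1 in the choice of covers add up to eps, and a
    sequence of covers can be rearranged into one. *)
Lemma Ibar_series S j (f : nat -> X -> \bar R) : (forall k T, 0 <= f k T) ->
  Ibar port j (fun T => \sum_(0 <= k <oo) f k T) S <=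
  \sum_(0 <= k <oo) Ibar port j (f k) S.
Proof.
move=> f0; have [[k kf]|/forallNP fin] := pselect (exists k, Ibar port j (f k) S = +oo).
  by rewrite (nneseries_pinfty _ _ kf) ?leey // => n _; exact: Ibar_ge0.
apply/lee_addgt0Pr => eps eps0.
apply: le_trans (epsilon_trick _ _ (ltW eps0)); last by move=> n; exact: Ibar_ge0.
have /choice[c cP] k : exists c, cover S j (f k) c /\
    c <= Ibar port j (f k) S + (eps / (2 ^ k.+1)%:R)%:E.
  have [|c fc ck] := @Ibar_lt S j (f k) (Ibar port j (f k) S + (eps / (2 ^ k.+1)%:R)%:E).
    rewrite lteDl ?lte_fin ?divr_gt0 ?ltr0n ?expn_gt0 //.
    by rewrite ge0_fin_numE ?Ibar_ge0 // ltey; apply/eqP/fin.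
  by exists c; split => //; exact: ltW.
apply: le_trans (cover_Ibar (cover_series f0 (fun k => (cP k).1))) _.
by apply: lee_nneseries => k *; [exact: cover_ge0 (cP k).1|exact: (cP k).2].
Qed.

Lemma coverD S j f f' c c' : cover S j f c -> cover S j f' c' ->
  cover S j (fun T => f T + f' T) (c + c').
Proof.
move=> [g [V [gV fg ->]]] [h [W [hW fh ->]]].
exists (fun m T => g m T + h m T)%R, (fun m => V m + W m)%R; split.
- by move=> m; exact: pos_representsD.
- move=> T ST; under eq_eseriesr do rewrite EFinD.
  rewrite nneseriesD ?leeD ?fg ?fh // => m _ _; rewrite lee_fin.
    exact: pos_represents_ge0 (gV m) _.
  exact: pos_represents_ge0 (hW m) _.
- under [RHS]eq_eseriesr do rewrite EFinD.
  rewrite nneseriesD // => m _ _; rewrite lee_fin.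
    exact: pos_represents_val_ge0 (gV m).
  exact: pos_represents_val_ge0 (hW m).
Qed.

Lemma IbarD S j f f' : Ibar port j (fun T => f T + f' T) S <=
  Ibar port j f S + Ibar port j f' S.
Proof.
have gtNy w : Ibar port j w S != -oo by rewrite gt_eqF // (lt_le_trans _ (Ibar_ge0 _ _ _)).
have [->|f1] := eqVneq (Ibar port j f S) +oo; first by rewrite addye ?leey.
have [->|f1'] := eqVneq (Ibar port j f' S) +oo; first by rewrite addey ?leey.
apply/lee_addgt0Pr => eps eps0; rewrite [eps]splitr EFinD addeACA.
have e2 : (0 < eps / 2)%R by rewrite divr_gt0.
have fin w : Ibar port j w S != +oo ->
    Ibar port j w S < Ibar port j w S + (eps / 2)%:E.
  by move=> gy; rewrite lteDl ?lte_fin // ge0_fin_numE ?Ibar_ge0 // ltey.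
have [c fc /ltW cf] := Ibar_lt (fin _ f1).
have [d fd /ltW df] := Ibar_lt (fin _ f1').
exact: le_trans (cover_Ibar (coverD fc fd)) (leeD cf df).
Qed.

Lemma Ibar_node S T j f : node S j T -> Ibar port j f T = Ibar port j f S.
Proof.
move=> ST; rewrite !IbarE /cover /pos_represents /Dnode_pos /Dnode /=.
by rewrite (represents_node ST) (node_eq ST).
Qed.

(** * Negligible sets *)

Definition negligible S j (E : set X) :=
  norm_cond port j (fun T => (\1_E T)%:E) S = 0.

Lemma norm_cond_indic S j (E : set X) :
  norm_cond port j (fun T => (\1_E T)%:E) S = Ibar port j (fun T => (\1_E T)%:E) S.
Proof. by congr (Ibar _ _ _ _); apply/funext => T; rewrite gee0_abs // lee_fin. Qed.

Lemma negligible_le S j (E : set X) :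
  (forall eps : R, (0 < eps)%R -> exists2 w, Ibar port j w S <= eps%:E &
     forall T, node S j T -> (\1_E T)%:E <= w T) -> negligible S j E.
Proof.
move=> H; rewrite /negligible norm_cond_indic; apply/eqP.
rewrite eq_le Ibar_ge0 andbT; apply/lee_addgt0Pr => eps /H[w weps Ew].
by rewrite add0e; exact: le_trans (Ibar_le Ew) weps.
Qed.

Lemma negligible_sub S j (E F : set X) : (forall T, node S j T -> E T -> F T) ->
  negligible S j F -> negligible S j E.
Proof.
rewrite /negligible !norm_cond_indic => EF F0; apply/eqP.
rewrite eq_le Ibar_ge0 andbT -F0; apply: Ibar_le => T ST.
rewrite lee_fin !indicE; have [/set_mem ET|//] := boolP (T \in E).
by rewrite (mem_set (EF _ ST ET)).
Qed.

Lemma negligibleU S j (E F : set X) : negligible S j E -> negligible S j F ->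
  negligible S j (E `|` F).
Proof.
rewrite /negligible !norm_cond_indic => E0 F0; apply/eqP.
rewrite eq_le Ibar_ge0 andbT -[leRHS]adde0 -{1}E0 -F0.
apply: le_trans (IbarD _ _ _ _); apply: Ibar_le => T ST.
rewrite -EFinD lee_fin !indicE in_setU.
by case: (T \in E); case: (T \in F); rewrite ?addr0 ?add0r ?lexx // lerDl.
Qed.

(** Countable subadditivity applied to infinitely many copies of the same
    indicator. A negligible set can thus be covered at arbitrarily small cost by
    a series that is +oo on it, whatever is to be hedged there. *)
Lemma Ibar_indic_infty S j (E : set X) : negligible S j E ->
  Ibar port j (fun T => if T \in E then +oo else 0) S = 0.
Proof.
rewrite /negligible norm_cond_indic => E0; apply/eqP; rewrite eq_le Ibar_ge0 andbT.
have := @Ibar_series S j (fun _ T => (\1_E T)%:E).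
rewrite E0 [X in _ -> _ <= X]eseries0 // => H.
apply: le_trans (H _) => [|k T]; last by rewrite lee_fin.
apply: Ibar_le => T _; rewrite indicE; case: (boolP (T \in E)) => _.
  rewrite (_ : \sum_(_ <= _ <oo) _ = +oo) //.
  apply/eqyP => A A0; pose n := Num.bound A.
  apply: (@le_trans _ _ (\sum_(0 <= k < n) (1%R)%:E)); last first.
    by apply: nneseries_lim_ge => k _ _; rewrite lee_fin.
  rewrite sumEFin lee_fin sumr_const_nat subn0.
  exact: ltW (archi_boundP (ltW A0)).
by apply: nneseries_ge0.
Qed.

Lemma ae_mono (P Q : X -> Prop) : (forall T, P T -> Q T) -> ae port P -> ae port Q.
Proof.
by move=> PQ aP S; apply: negligible_sub (aP S) => T _; exact: contra_not (PQ T).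
Qed.

Lemma ae_and (P Q : X -> Prop) : ae port P -> ae port Q ->
  ae port (fun T => P T /\ Q T).
Proof.
move=> aP aQ S; apply: negligible_sub (negligibleU (aP S) (aQ S)) => T _ /=.
by move=> /not_andP.
Qed.

Lemma ae_node_mono S j (P Q : X -> Prop) : (forall T, node S j T -> P T -> Q T) ->
  ae_node port S j P -> ae_node port S j Q.
Proof.
move=> PQ; apply: negligible_sub => T _ [ST nQ]; split => //.
exact: contra_not (PQ _ ST) nQ.
Qed.

Lemma ae_node_and S j (P Q : X -> Prop) : ae_node port S j P -> ae_node port S j Q ->
  ae_node port S j (fun T => P T /\ Q T).
Proof.
move=> aP aQ; apply: negligible_sub (negligibleU aP aQ) => T _ /= [ST].
by move=> /not_andP[]; [left|right].
Qed.

(** * Conditional integral *)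

(** The negative part of a hedge is a single payoff, here h2; the payoff h1 is put
    in front of the cover of w. *)
Lemma sigma_up_le S j f h1 h2 V1 V2 w (eps : R) :
  pos_represents S j h1 V1 -> pos_represents S j h2 V2 -> Ibar port j w S < eps%:E ->
  (forall T, node S j T -> f T <= (h1 T - h2 T)%:E + w T) ->
  sigma_up port j f S <= (V1 - V2 + eps)%:E.
Proof.
move=> h1V h2V /Ibar_lt[_ [g [V [gV wg ->]]] /ltW geps] fw.
apply: (@le_trans _ _ ((- V2)%:E + \sum_(0 <= m <oo) (cons_seq V1 V m)%:E)).
  apply: ereal_inf_lbound; exists h2, V2, (cons_seq h1 g), (cons_seq V1 V).
  split => //; first by case.
  move=> T ST.
  rewrite (eq_eseriesr (g := fun m => (cons_seq (h1 T) (g^~ T) m)%:E)); last by case.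
  rewrite nneseries_cons ?(pos_represents_ge0 h1V)//; last first.
    by move=> n; exact: pos_represents_ge0 (gV n) _.
  apply: le_trans (fw _ ST) (le_trans (leeD (lexx _) (wg _ ST)) _).
  by rewrite addeA -EFinD [(- _ + _)%R]addrC.
rewrite nneseries_cons ?(pos_represents_val_ge0 h1V)//; last first.
  by move=> n; exact: pos_represents_val_ge0 (gV n).
apply: le_trans (leeD (lexx _) (leeD (lexx _) geps)) _.
by rewrite -!EFinD lee_fin; lra.
Qed.

(** On the exceptional set the domination is forced by adding a series that is
    +oo there and has arbitrarily small cost. *)
Lemma sigma_up_le_ae S j f h1 h2 V1 V2 w (eps : R) :
  pos_represents S j h1 V1 -> pos_represents S j h2 V2 -> (forall T, 0 <= w T) ->
  Ibar port j w S < eps%:E ->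
  ae_node port S j (fun T => f T <= (h1 T - h2 T)%:E + w T) ->
  sigma_up port j f S <= (V1 - V2 + eps)%:E.
Proof.
move=> h1V h2V w0 weps /Ibar_indic_infty.
set E := [set _ | _] => E0.
apply: (@sigma_up_le S j f h1 h2 _ _ (fun T => w T + if T \in E then +oo else 0)) => //.
  by apply: le_lt_trans (IbarD _ _ _ _) _; rewrite E0 adde0.
move=> T ST; case: ifPn => [_|/negP TE].
  by rewrite addey ?leey // gt_eqF // (lt_le_trans _ (w0 T)).
by rewrite adde0; apply: contra_notP TE => nf; apply: mem_set; split.
Qed.

(** Adding a hedge of f to a hedge of -f gives a hedge of zero, whose price is
    non-negative. Where f is infinite one of the two series is +oo, and the
    other one is bounded below, so the sum still dominates zero. *)
Lemma sigma_low_le_up S j f : sigma_low port j f S <= sigma_up port j f S.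
Proof.
apply: le_ereal_inf_tmp => c [g0 [V0 [g [V [g0V gV fg ->]]]]].
rewrite /sigma_low leeNl.
apply: le_ereal_inf_tmp => d [h0 [W0 [h [W [h0W hW fh ->]]]]].
have V0' : 0 <= \sum_(0 <= m <oo) (V m)%:E.
  by apply: nneseries_ge0 => n _ _; rewrite lee_fin (pos_represents_val_ge0 (gV n)).
have W0' : 0 <= \sum_(0 <= m <oo) (W m)%:E.
  by apply: nneseries_ge0 => n _ _; rewrite lee_fin (pos_represents_val_ge0 (hW n)).
have : 0 <= (- (V0 + W0))%:E + \sum_(0 <= m <oo) (V m + W m)%:E.
  apply: (sigma_up_ge0 (pos_representsD g0V h0W)
    (fun m => pos_representsD (gV m) (hW m))) => T ST.
  under eq_eseriesr do rewrite EFinD.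
  rewrite nneseriesD; last 2 first.
  - by move=> n _ _; rewrite lee_fin (pos_represents_ge0 (gV n)).
  - by move=> n _ _; rewrite lee_fin (pos_represents_ge0 (hW n)).
  have := fg _ ST; have := fh _ ST.
  have : 0 <= \sum_(0 <= m <oo) (g m T)%:E.
    by apply: nneseries_ge0 => n _ _; rewrite lee_fin (pos_represents_ge0 (gV n)).
  have : 0 <= \sum_(0 <= m <oo) (h m T)%:E.
    by apply: nneseries_ge0 => n _ _; rewrite lee_fin (pos_represents_ge0 (hW n)).
  move: (\sum_(_ <= _ <oo) _) (\sum_(_ <= _ <oo) _) (f T) => a b x.
  by case: a => [a| |] //; case: b => [b| |] //; case: x => [x| |] //=;
    rewrite ?lee_fin ?leey // => ? ? ? ?; lra.
under eq_eseriesr do rewrite EFinD.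
rewrite nneseriesD; last 2 first.
- by move=> n _ _; rewrite lee_fin (pos_represents_val_ge0 (gV n)).
- by move=> n _ _; rewrite lee_fin (pos_represents_val_ge0 (hW n)).
move: V0' W0'; set a := \sum_(_ <= _ <oo) (V _)%:E; set b := \sum_(_ <= _ <oo) (W _)%:E.
case: a => [a| |] // _; last by move=> _ _; rewrite addey //= leNye.
case: b => [b| |] // _; last by move=> _; rewrite addey //= leey.
by rewrite -!EFinD -EFinN !lee_fin; lra.
Qed.

(** * Series of payoffs *)

Lemma Mclass_ge0 S j v : Mclass port j S v -> forall T, 0 <= v T.
Proof.
by case=> g [gD _ ->] T; apply: nneseries_ge0 => n _ _; rewrite lee_fin (gD n).2.
Qed.

Lemma MclassD S j u v : Mclass port j S u -> Mclass port j S v ->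
  Mclass port j S (fun T => u T + v T).
Proof.
case=> g [gD gS ->] [h [hD hS ->]].
exists (fun m T => g m T + h m T)%R; split.
- by move=> m; exact: Dglob_posD.
- under eq_eseriesr do rewrite I_D // EFinD.
  rewrite nneseriesD ?lte_add_pinfty // => n _ _; rewrite lee_fin I_ge0 //.
- apply/funext => T; under [RHS]eq_eseriesr do rewrite EFinD.
  by rewrite nneseriesD // => n _ _; rewrite lee_fin ?(gD n).2 ?(hD n).2.
Qed.

Lemma Mclass_Dglob S j h : Dglob_pos port j h -> Mclass port j S (fun T => (h T)%:E).
Proof.
move=> hD; exists (cons_seq h (fun _ _ => 0%R)); split.
- by case => [//|m]; exact: Dglob_pos0.
- rewrite (eq_eseriesr (g := fun m => (cons_seq (I port j h S) (fun=> 0%R) m)%:E)).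
    by rewrite eseries_single ltry.
  by case => [//|m] _ /=; rewrite I0.
- apply/funext => T.
  rewrite (eq_eseriesr (g := fun m => (cons_seq (h T) (fun=> 0%R) m)%:E)).
    by rewrite eseries_single.
  by case.
Qed.

(** A partial sum of payoffs is a payoff, and the tail covers itself, at a cost
    that tends to zero. *)
Lemma Mclass_split S j v (eps : R) : Mclass port j S v -> (0 < eps)%R ->
  exists h v', [/\ Dglob_pos port j h, Mclass port j S v',
    Ibar port j v' S <= eps%:E & v = fun T => (h T)%:E + v' T].
Proof.
case=> g [gD gS ->] eps0.
have I0' k : 0 <= (I port j (g k) S)%:E by rewrite lee_fin I_ge0.
have [N tailN] : exists N, \sum_(N <= k <oo) (I port j (g k) S)%:E < eps%:E.
  have /(_ (fun x => x < eps%:E)) := nneseries_tail_cvg gS (fun k _ => I0' k).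
  case; first by apply: open_ereal_lt'; rewrite lte_fin.
  by move=> N _ /(_ N (leqnn N)); exists N.
exists (fun T => \sum_(0 <= m < N) g m T)%R, (fun T => \sum_(0 <= m <oo) (g (m + N)%N T)%:E).
split.
- exact: Dglob_pos_sum.
- exists (fun m => g (m + N)%N); split => //.
  rewrite (nneseries_addn (f := fun m => (I port j (g m) S)%:E)) //.
  exact: lt_trans tailN (ltry _).
- apply: le_trans (ltW tailN).
  rewrite -(nneseries_addn (f := fun m => (I port j (g m) S)%:E)) //.
  apply: cover_Ibar.
  exists (fun m => restr0 S j (g (m + N)%N)), (fun m => I port j (g (m + N)%N) S).
  split => // [m|T ST]; first exact: pos_represents_I.
  by under [leRHS]eq_eseriesr do rewrite restr0_in //.
- apply/funext => T; rewrite (nneseries_split 0 N); last first.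
    by move=> k _; rewrite lee_fin (gD k).2.
  rewrite add0n sumEFin; congr (_ + _).
  by rewrite -nneseries_addn // => k; rewrite lee_fin (gD k).2.
Qed.

(** Where v is infinite, each of its tails is infinite too, and hence at least 1. *)
Lemma Mclass_fin S j v : Mclass port j S v -> ae_node port S j (fun T => v T < +oo).
Proof.
move=> Mv; apply: negligible_le => eps eps0.
have [h [v' [hD Mv' v'eps vE]]] := Mclass_split Mv eps0.
exists v' => // T ST; rewrite indicE.
case: (boolP (_ \in _)) => [/set_mem[_ /negP]|_]; last exact: Mclass_ge0 Mv' _.
rewrite -leNgt leye_eq vE => /eqP; case: (v' T) => [//| |//] _; exact: leey.
Qed.

Lemma Mclass_node S T j : node S j T -> Mclass port j T = Mclass port j S.
Proof.
move=> ST; have IE g : I port j g T = I port j g S.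
  by rewrite /I /restr0 (represents_node ST) (node_eq ST).
have sE (g : nat -> X -> R) : \sum_(0 <= m <oo) (I port j (g m) T)%:E =
    \sum_(0 <= m <oo) (I port j (g m) S)%:E.
  by apply: eq_eseriesr => m _; rewrite IE.
by apply/seteqP; split => v [g [gD gS ->]]; exists g; split; rewrite // ?sE // -sE.
Qed.

(** * Decompositions at a node *)

(** Isolated from LKclass, like [Lclass_at] from Lclass, so that the arguments
    below deal with one node, away from the null set of bad nodes. *)
Definition LKclass_at j S f := forall eps : R, (0 < eps)%R -> exists u v h,
  [/\ Mclass port j S u /\ Mclass port j S v, Enode port S j h,
      ae_node port S j (fun T => f T = ((h T)%:E + v T - u T)%dE),
      Ibar port j u S <= eps%:E & Ibar port j v S <= eps%:E].

Definition Lclass_at j S f := forall eps : R, (0 < eps)%R -> exists u v,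
  [/\ Mclass port j S u, Mclass port j S v,
      ae_node port S j (fun T => f T = (v T - u T)%dE)
    & Ibar port j u S <= eps%:E].

(** If f = h1 - h2 + v - u with values V1 and V2 of h1 and h2 and with u, v of
    norm at most eps / 2, then f is dominated by h1 - h2 + v and -f by
    h2 - h1 + u. Hence V1 - V2 - eps <= sigma_low <= sigma_up <= V1 - V2 + eps. *)
Lemma sigma_eq j S f : LKclass_at j S f ->
  exists r : R, sigma_up port j f S = r%:E /\ sigma_low port j f S = r%:E.
Proof.
move=> fS.
have bounds eps : (0 < eps)%R -> exists r : R,
    sigma_up port j f S <= (r + eps)%:E /\ (r - eps)%:E <= sigma_low port j f S.
  move=> eps0; have e2 : (0 < eps / 2)%R by rewrite divr_gt0.
  have [u [v [_ [[Mu Mv] [h1 /pos_represents_ex[V1 h1V] [h2 /pos_represents_ex[V2 h2V] <-]]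
    fE ueps veps]]]] := fS _ e2.
  have lt_eps w : Ibar port j w S <= (eps / 2)%:E -> Ibar port j w S < eps%:E.
    by move=> /le_lt_trans; apply; rewrite lte_fin; lra.
  have {fE}fle := ae_node_mono (fun T _ => dsub_le (Mclass_ge0 Mv T) (Mclass_ge0 Mu T)) fE.
  exists (V1 - V2)%R; split.
    apply: (sigma_up_le_ae h1V h2V (Mclass_ge0 Mv) (lt_eps _ veps)).
    by apply: ae_node_mono fle => T _ [].
  rewrite /sigma_low leeNr -EFinN (_ : - (V1 - V2 - eps) = V2 - V1 + eps)%R; last by lra.
  apply: (sigma_up_le_ae h2V h1V (Mclass_ge0 Mu) (lt_eps _ ueps)).
  by apply: ae_node_mono fle => T _ [_]; rewrite opprB.
have lu := sigma_low_le_up S j f.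
have [r0 [up0 low0]] := bounds 1%R ltr01.
have up_fin : sigma_up port j f S \is a fin_num.
  rewrite fin_numElt (lt_le_trans _ (le_trans low0 lu)) ?ltNyr //.
  exact: le_lt_trans up0 (ltry _).
have low_fin : sigma_low port j f S \is a fin_num.
  rewrite fin_numElt (lt_le_trans _ low0) ?ltNyr //.
  exact: le_lt_trans (le_trans lu up0) (ltry _).
exists (fine (sigma_up port j f S)); rewrite fineK //; split=> //.
apply/eqP; rewrite eq_le lu; apply/lee_addgt0Pr => eps eps0.
have [|r [up low]] := bounds (eps / 2)%R; first by rewrite divr_gt0.
apply: le_trans up _; apply: le_trans (leeD low (lexx _)).
by rewrite -EFinD lee_fin; lra.
Qed.

(** Split v1 and v2 of f1 = v1 - u1 and f2 = v2 - u2 into payoffs h1, h2 and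
    small tails: f1 - f2 is h1 - h2 plus a difference of small series. All
    these series are finite almost everywhere, so the terms may be regrouped. *)
Lemma Ldiff_LKclass_at j S f1 f2 : Lclass_at j S f1 -> Lclass_at j S f2 ->
  LKclass_at j S (fun T => f1 T - f2 T)%dE.
Proof.
move=> L1 L2 eps eps0; have e2 : (0 < eps / 2)%R by rewrite divr_gt0.
have [u1 [w1 [Mu1 Mw1 f1E u1e]]] := L1 _ e2.
have [u2 [w2 [Mu2 Mw2 f2E u2e]]] := L2 _ e2.
have [h1 [v1 [h1D Mv1 v1e w1E]]] := Mclass_split Mw1 e2.
have [h2 [v2 [h2D Mv2 v2e w2E]]] := Mclass_split Mw2 e2.
have sum_eps w w' : Ibar port j w S <= (eps / 2)%:E ->
    Ibar port j w' S <= (eps / 2)%:E -> Ibar port j (fun T => w T + w' T) S <= eps%:E.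
  move=> we w'e; apply: le_trans (IbarD _ _ _ _) _.
  by rewrite [eps]splitr EFinD; exact: leeD.
exists (fun T => u1 T + v2 T), (fun T => v1 T + u2 T),
  (fun T => restr0 S j h1 T - restr0 S j h2 T)%R.
split; [by split; exact: MclassD| | |exact: sum_eps|exact: sum_eps].
  exists (restr0 S j h1); first exact: (pos_represents_I S h1D).1.
  by exists (restr0 S j h2); first exact: (pos_represents_I S h2D).1.
have := ae_node_and (ae_node_and f1E f2E) (ae_node_and
  (ae_node_and (Mclass_fin Mu1) (Mclass_fin Mu2))
  (ae_node_and (Mclass_fin Mv1) (Mclass_fin Mv2))).
apply: ae_node_mono => T ST [[-> ->] [[u1y u2y] [v1y v2y]]].
by rewrite w1E w2E !restr0_in // dsub_merge ?(Mclass_ge0 Mu1) ?(Mclass_ge0 Mu2)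
  ?(Mclass_ge0 Mv1) ?(Mclass_ge0 Mv2).
Qed.

(** The decomposition of f with payoffs h1, h2 is read as the difference of the
    series h1 + v and h2 + u, with no smallness left. *)
Lemma LKclass_at_diff j S f : LKclass_at j S f -> exists w1 w2,
  [/\ Mclass port j S w1, Mclass port j S w2 &
      ae_node port S j (fun T => f T = (w1 T - w2 T)%dE)].
Proof.
move=> /(_ 1%R ltr01)[u [v [_ [[Mu Mv] [h1 h1D [h2 h2D <-]] fE _ _]]]].
exists (fun T => (h1 T)%:E + v T), (fun T => (h2 T)%:E + u T); split.
- exact: MclassD (Mclass_Dglob S (Dglob_pos_restr0 h1D)) Mv.
- exact: MclassD (Mclass_Dglob S (Dglob_pos_restr0 h2D)) Mu.
- apply: ae_node_mono fE => T _ ->; rewrite dsub_split //.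
    exact: Mclass_ge0 Mv _.
  exact: Mclass_ge0 Mu _.
Qed.

(** The subtracted series u can be taken to be zero, for every eps at once. *)
Lemma Lclass_of_Mclass j (w1 : X -> \bar R) : (forall T, 0 <= w1 T) ->
  ae port (fun S => exists2 w, Mclass port j S w & ae_node port S j (fun T => w1 T = w T)) ->
  Lclass port j w1.
Proof.
move=> w0 ae_w; split => //; apply: ae_mono ae_w => S [w Mw wE] eps eps0.
exists (fun=> 0), w; split=> //.
- exact: Mclass_Dglob (Dglob_pos0 j).
- by apply: ae_node_mono wE => T _ ->; case: (w T) => //= r; rewrite ?oppr0 ?addr0.
- apply: (@le_trans _ _ 0); last by rewrite lee_fin ltW.
  apply: cover_Ibar; exists (fun _ _ => 0%R), (fun=> 0%R); split.
  + by move=> m; exact: pos_represents0.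
  + by move=> T _; rewrite eseries0.
  + by rewrite eseries0.
Qed.

(** On each node f is a difference of two series outside a negligible set. These
    series are chosen once per node, through a representative [rep] of the node,
    and glued into two functions; the choice is corrected on the exceptional
    set, where the positive and negative parts of f are used instead. *)
Lemma LKclass_sub_Ldiff j f (S0 : X) : LKclass port j f -> Ldiff port j f.
Proof.
move=> fLK.
(* The node contains S, so the default S0 is never returned, and the choice
   depends on the node only. *)
pose rep S : X := xget S0 (node S j).
have repN S : node S j (rep S) by apply: xgetPex; exists S.
have repE S T : node S j T -> rep T = rep S by rewrite /rep => /node_eq ->.
pose dec S (w1 w2 : X -> \bar R) := [/\ Mclass port j S w1, Mclass port j S w2 &
  ae_node port S j (fun T => f T = (w1 T - w2 T)%dE)].
have decE S : dec (rep S) = dec S.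
  by rewrite /dec (Mclass_node (repN S)) /ae_node /norm_cond;
    apply/funext => a; apply/funext => b; rewrite (Ibar_node _ (repN S)) (node_eq (repN S)).
have /choice[w1 /choice[w2 wP]] S : exists w1 w2, [/\ forall T, 0 <= w1 T,
    forall T, 0 <= w2 T & (exists w1' w2', dec S w1' w2') -> dec S w1 w2].
  have [[w1 [w2 [M1 M2 fE]]]|ndec] := pselect (exists w1 w2, dec S w1 w2).
    by exists w1, w2; split=> // T; [exact: Mclass_ge0 M1 _|exact: Mclass_ge0 M2 _].
  by exists (fun=> 0), (fun=> 0).
pose good T := f T == (w1 (rep T) T - w2 (rep T) T)%dE.
pose f1 T := if good T then w1 (rep T) T else maxe (f T) 0.
pose f2 T := if good T then w2 (rep T) T else maxe (- f T) 0.
have wS S : LKclass_at j S f ->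
    [/\ Mclass port j S (w1 (rep S)), Mclass port j S (w2 (rep S)) &
      ae_node port S j good].
  move=> /LKclass_at_diff fS; have [_ _ w12] := wP (rep S).
  have [M1 M2 fE] : dec S (w1 (rep S)) (w2 (rep S)).
    by rewrite -decE; apply: w12; rewrite decE.
  split=> //.
  by apply: ae_node_mono fE => T ST; rewrite /good (repE _ _ ST) => ->.
have aeP := fLK : ae port (fun S => LKclass_at j S f).
exists f1.
  apply: Lclass_of_Mclass => [T|].
    by rewrite /f1; case: ifP => _; [have [] := wP (rep T)|rewrite le_max lexx orbT].
  apply: ae_mono aeP => S /wS[M1 _ gS]; exists (w1 (rep S)) => //.
  by apply: ae_node_mono gS => T ST gT; rewrite /f1 gT (repE _ _ ST).
exists f2.
  apply: Lclass_of_Mclass => [T|].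
    by rewrite /f2; case: ifP => _; [have [] := wP (rep T)|rewrite le_max lexx orbT].
  apply: ae_mono aeP => S /wS[_ M2 gS]; exists (w2 (rep S)) => //.
  by apply: ae_node_mono gS => T ST gT; rewrite /f2 gT (repE _ _ ST).
apply/funext => T; rewrite /f1 /f2; case: ifP => [/eqP->//|_].
exact: dsub_pos_neg.
Qed.

End ConditionalIntegral.

Theorem proposition9 (R : realType) (s0 : R) (X : set (nat -> R))
    (X_neq0 : X !=set0) (X_start : forall S, X S -> S 0%N = s0)
    (port : X -> nat -> set (nat -> X -> R))
    (port_ax : portfolio_system port)
    (neutral : local_0_neutral X)
    (sigma0 : forall (j : nat) (S : X), sigma_up port j (fun=> 0%E) S = 0%E)
    (j : nat) :
  (forall f : X -> \bar R, LKclass port j f ->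
     ae port (fun S => sigma_low port j f S = sigma_up port j f S)) /\
  Ldiff port j = LKclass port j /\
  LKclass port j `<=` Lsigma port j.
Proof.
have sigma_fin f : LKclass port j f -> ae port (fun S => exists r : R,
    sigma_up port j f S = r%:E /\ sigma_low port j f S = r%:E).
  by apply: (ae_mono port_ax sigma0) => S; exact: (sigma_eq port_ax sigma0).
split; last split.
- by move=> f /sigma_fin; apply: (ae_mono port_ax sigma0) => S [r [-> ->]].
- apply/seteqP; split => f.
    move=> [f1 [_ L1] [f2 [_ L2] <-]].
    by apply: (ae_mono port_ax sigma0) (ae_and port_ax sigma0 L1 L2) => S [];
      exact: (Ldiff_LKclass_at port_ax sigma0).
  by case: X_neq0 => S XS; exact: (LKclass_sub_Ldiff port_ax sigma0 (exist _ S (mem_set XS))).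
- move=> f /sigma_fin; apply: (ae_mono port_ax sigma0) => S [r [-> ->]].
  by congr EFin; exact: subrr.
Qed.
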